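(* Let $s\in\mathbb N$, $f\in C^\infty([0,1]^s)$, and let $A_s,B_s>0$, $c_s$ and $N_m$ be as in the context. For $m\in\mathbb N$ let $$\mathrm{SUM}_{1,m}=\sum_{\boldsymbol k\in Q_{N_m}}Z(\boldsymbol k)S(\boldsymbol k)\hat f(\boldsymbol k),\qquad \mathrm{SUM}'_{1,m}=\sum_{\boldsymbol k\in Q_{N_m}}Z(\boldsymbol k)S'(\boldsymbol k)\hat f(\boldsymbol k),$$ where the $S'(\boldsymbol k)$ are i.i.d. uniform on $\{-1,1\}$ and independent of everything else. Under the complete random design there exist constants $d_s$ and $\underline m_s$ depending on $s$ such that for all $m\ge\underline m_s$, $$d_{TV}(\mathrm{SUM}_{1,m},\mathrm{SUM}'_{1,m})\le\frac1{c_sm}+m^{d_s}2^{-4c_sm}.$$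
   Context: Binary digits: for $k\in\mathbb N_0$, $k=\sum_{\ell\ge1}a_\ell2^{\ell-1}$, $\vec k=(a_1,a_2,\dots)$, $\kappa=\{\ell:a_\ell=1\}$; for $x\in[0,1)$, $\vec x$ its binary digits. For $\boldsymbol k\in\mathbb N_0^s$ with digit sets $\boldsymbol\kappa=(\kappa_1,\dots,\kappa_s)$, $\|\boldsymbol\kappa\|_1=\sum_j\sum_{\ell\in\kappa_j}\ell$; $\mathbb N_*^s=\mathbb N_0^s\setminus\{\boldsymbol0\}$, $Q_N=\{\boldsymbol k\in\mathbb N_*^s:\|\boldsymbol\kappa\|_1\le N\}$; $\hat f(\boldsymbol k)=\int f(\boldsymbol x)(-1)^{\sum_j\vec k_j^{\mathsf T}\vec x_j}\mathrm d\boldsymbol x$. $\oplus$ on $\mathbb N_0^s$ is componentwise bitwise XOR. $\lambda=3(\log2)^2/\pi^2$. Constants: $A_s,B_s>0$ are constants depending only on $s$ such that for all $N\ge1$ and $r\ge2$, if $\boldsymbol k_1,\dots,\boldsymbol k_r$ are i.i.d. uniform on $Q_N$ then $\Pr(\oplus_{i=1}^r\boldsymbol k_i\in Q_N)\le A_s^rN^{r/4}r^{-B_s\sqrt N}$ (such constants exist). Set $c_s=\frac14B_s\sqrt{\lambda/s}$ and $N_m=\sup\{N\in\mathbb N_0:|Q_N|\le c_sm2^m\}$. Randomization: random $C_j\in\{0,1\}^{\infty\times m}$ with all entries i.i.d. uniform on $\{0,1\}$ (complete random design), and digital shifts $\vec D_j\in\{0,1\}^\infty$ with i.i.d. uniform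 entries, independent of the $C_j$. $Z(\boldsymbol k)=\mathbf 1\{\sum_j\sum_{\ell\in\kappa_j}C_j(\ell,:)=\boldsymbol0\bmod2\}$ and $S(\boldsymbol k)=(-1)^{\sum_j\vec k_j^{\mathsf T}\vec D_j}$. $d_{TV}(X,Y)=\sup_{A\text{ Borel}}|\Pr(X\in A)-\Pr(Y\in A)|$. *)

(* Defs.v *)
From HB Require Import structures.
From mathcomp Require Import all_boot all_order all_algebra.
From mathcomp Require Import all_classical all_reals all_analysis.
Set Implicit Arguments. Unset Strict Implicit. Unset Printing Implicit Defensive.
Import Order.TTheory GRing.Theory Num.Theory.
Import numFieldNormedType.Exports.
Local Open Scope ring_scope.
Local Open Scope classical_set_scope.

(* bit l of n (l = 0,1,...), i.e. a_{l+1} in the paper's notation *)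
Definition nbit (n l : nat) : bool := odd (n %/ 2 ^ l).

Definition digit_weight (n : nat) : nat :=
  (\sum_(l < n) (nbit n l) * l.+1)%N.

Definition kweight (s : nat) (k : 'I_s -> nat) : nat :=
  (\sum_(j < s) digit_weight (k j))%N.

Definition inQ (s N : nat) (k : 'I_s -> nat) : bool :=
  [exists j, k j != 0%N] && (kweight k <= N)%N.

(* Every element of Q_N has all coordinates < 2^N; we therefore carry Q_N
   inside the finite type Kt s N of s-tuples of numbers < 2^N. *)
Definition Kt (s N : nat) := {ffun 'I_s -> 'I_(2 ^ N)}.
Definition kval (s N : nat) (k : Kt s N) : 'I_s -> nat := fun j => nat_of_ord (k j).
Definition QN (s N : nat) : {set Kt s N} := [set k | inQ N (kval k)].

Definition xorv (s N r : nat) (t : {ffun 'I_r -> Kt s N}) : 'I_s -> nat :=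
  fun j => \big[Nat.lxor/0%N]_(i < r) kval (t i) j.

Definition xor_prob (R : realType) (s N r : nat) : R :=
  #|[set t : {ffun 'I_r -> Kt s N} | [forall i, t i \in QN s N] && inQ N (xorv t)]|%:R
  / (#|QN s N| ^ r)%:R.

Definition lambda (R : realType) : R := 3 * (ln 2) ^+ 2 / pi ^+ 2.
Definition c_const (R : realType) (s : nat) (B : R) : R :=
  B / 4 * Num.sqrt (lambda R / s%:R).

Definition is_Nm (R : realType) (s : nat) (c : R) (m N : nat) : Prop :=
  (#|QN s N|%:R <= c * m%:R * 2 ^+ m) /\
  (forall N', #|QN s N'|%:R <= c * m%:R * 2 ^+ m -> (N' <= N)%N).

Definition dpartial (R : realType) (s : nat) (i : 'I_s) (g : 'rV[R]_s -> R)
  : 'rV[R]_s -> R := 'D_(delta_mx 0 i : 'rV[R]_s) g.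
Definition iter_partial (R : realType) (s : nat) (l : seq 'I_s) (g : 'rV[R]_s -> R)
  : 'rV[R]_s -> R := foldr (@dpartial R s) g l.
Definition smooth_Rs (R : realType) (s : nat) (g : 'rV[R]_s -> R) : Prop :=
  forall l : seq 'I_s, continuous (iter_partial l g) /\
    (forall (i : 'I_s) (x : 'rV[R]_s), derivable (iter_partial l g) x (delta_mx ord0 i)).
Definition unit_cube (R : realType) (s : nat) : set 'rV[R]_s :=
  [set x | forall j : 'I_s, 0 <= x ord0 j <= 1].
Definition smooth_cube (R : realType) (s : nat) (f : 'rV[R]_s -> R) : Prop :=
  exists g, smooth_Rs g /\ (forall x, unit_cube x -> f x = g x).

(* l-th (0-based) binary digit of y in [0,1), i.e. x_{l+1} in the paper *)
Definition xdigit (R : realType) (l : nat) (y : R) : bool :=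
  odd (absz (Num.floor (y * 2 ^+ l.+1))).
Definition walsh (R : realType) (s : nat) (k : 'I_s -> nat) (x : 'rV[R]_s) : R :=
  (-1) ^+ (\sum_(j < s) \sum_(l < k j) (nbit (k j) l && xdigit l (x ord0 j)))%N.
Definition setc (R : realType) (s : nat) (x : 'rV[R]_s) (j : 'I_s) (t : R) : 'rV[R]_s :=
  \row_i (if i == j then t else x ord0 i).
Definition integ_coord (R : realType) (s : nat) (j : 'I_s) (h : 'rV[R]_s -> R)
  : 'rV[R]_s -> R :=
  fun x => Rintegral lebesgue_measure `[0, 1] (fun t => h (setc x j t)).
Definition cube_integral (R : realType) (s : nat) (h : 'rV[R]_s -> R) : R :=
  foldr (@integ_coord R s) h (enum 'I_s) 0.
Definition fhat (R : realType) (s : nat) (f : 'rV[R]_s -> R) (k : 'I_s -> nat) : R :=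
  cube_integral (fun x => f x * walsh k x).

(* outcome = (rows 1..N of C_1..C_s, digits 1..N of D_1..D_s, signs S'(k)) *)
Definition Omega (s N m : nat) : finType :=
  ({ffun 'I_s -> {ffun 'I_N -> {ffun 'I_m -> bool}}}
   * {ffun 'I_s -> {ffun 'I_N -> bool}} * {ffun Kt s N -> bool})%type.

Definition Zk (s N m : nat) (k : Kt s N) (w : Omega s N m) : bool :=
  [forall c : 'I_m,
     ~~ \big[addb/false]_(j < s) \big[addb/false]_(l < N)
          (nbit (kval k j) l && w.1.1 j l c)].
Definition Sk (R : realType) (s N m : nat) (k : Kt s N) (w : Omega s N m) : R :=
  (-1) ^+ (\big[addb/false]_(j < s) \big[addb/false]_(l < N)
             (nbit (kval k j) l && w.1.2 j l)).
Definition Sk' (R : realType) (s N m : nat) (k : Kt s N) (w : Omega s N m) : R :=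
  (-1) ^+ (w.2 k).

Definition SUM1 (R : realType) (s N m : nat) (f : 'rV[R]_s -> R) (w : Omega s N m) : R :=
  \sum_(k in QN s N) (Zk k w)%:R * Sk R k w * fhat f (kval k).
Definition SUM1' (R : realType) (s N m : nat) (f : 'rV[R]_s -> R) (w : Omega s N m) : R :=
  \sum_(k in QN s N) (Zk k w)%:R * Sk' R k w * fhat f (kval k).

Definition prob (R : realType) (T : finType) (E : set T) : R :=
  #|[set w : T | `[< E w >] ]|%:R / #|T|%:R.
Definition dTV (R : realType) (T : finType) (X Y : T -> R) : R :=
  sup [set `| prob R (X @^-1` A) - prob R (Y @^-1` A) |
        | A in [set A : set R | measurable A]].

(* Main.v *)
(* Call V the set of k in Q_N with Z(k) = 1.  If V is linearly independent over
   F_2, then adding dual vectors to the digital shifts exchanges, by a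
   measure-preserving involution, the signs S(k) and S'(k) for all k in V; hence
   the total variation distance is at most the probability that V is dependent.
   By pairwise independence of the Z(k) and Chebyshev, |V| > 2 c m has
   probability at most 1/(c m).  Otherwise a minimal dependent subset of V gives
   2 <= r < 2 c m independent elements of V whose xor lies in Q_N, and the union
   bound is the sum over r of (|Q_N| 2^-m)^r times the xor probability.
   As sqrt N >= sqrt(lambda/s) m - 1, the r-th term is at most a power of m times
   (c m)^(2r) r^(-4 c m), which is largest at r = 2 because ln is concave.
   The bound on sqrt N rests on |Q_N| <= exp(pi sqrt(s N / 3)), which follows from
   the generating function prod_l (1 + x^l)^s, Euler's
   prod_l (1 + x^l) = exp(sum_n 1 / (n (x^-n - x^n))) and zeta(2) <= pi^2 / 6. *)
From Stdlib Require PeanoNat.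
Require Import Defs.
From HB Require Import structures.
From mathcomp Require Import all_boot all_order all_algebra.
From mathcomp Require Import all_classical all_reals all_analysis.
From mathcomp Require Import ring lra zify.
Set Implicit Arguments. Unset Strict Implicit. Unset Printing Implicit Defensive.
Import Order.TTheory GRing.Theory Num.Theory.
Import numFieldNormedType.Exports.
Local Open Scope ring_scope.
Local Open Scope classical_set_scope.

(** * Linear independence over F_2 *)

(** The booleans form the field F_2, so the vectors [b i] are the rows of a matrix [M]. Nonvanishing
    subset sums make [M] row free, and the columns of its right inverse [pinvmx M] are the dual
    vectors. *)
Lemma dual_family (I T : finType) (b : I -> T -> bool) (W : {set I}) :
  (forall U : {set I}, U \subset W -> U != finset.set0 ->
     exists t, \big[addb/false]_(i in U) b i t) ->
  exists y : I -> T -> bool, {in W &, forall i i',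
     \big[addb/false]_(t : T) (b i t && y i' t) = (i == i')}.
Proof.
move=> indW.
case: (set_0Vmem W) => [->|[x0 x0W]]; first by exists (fun _ _ => false) => i; rewrite inE.
pose M : 'M[bool]_(#|W|, #|T|) := \matrix_(i, j) b (enum_val i) (enum_val j).
have freeM : row_free M.
  apply: inj_row_free => v vM0; apply/rowP => i0; rewrite mxE.
  apply/negbTE/negP => vi0.
  pose U : {set I} := [set enum_val i | i : 'I_#|W| & v ord0 i]%SET.
  have UW : U \subset W.
    by apply/fintype.subsetP => x /imsetP[i _ ->]; exact: enum_valP.
  have U0 : U != finset.set0.
    apply/set0Pn; exists (enum_val i0); apply/imsetP; exists i0 => //.
    by rewrite inE.
  have [t] := indW _ UW U0; rewrite big_imset /=; last first.
    by move=> i j _ _; exact: enum_val_inj.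
  have /rowP/(_ (enum_rank t)) := vM0; rewrite !mxE => vMt.
  under eq_bigl do rewrite inE.
  (* The [addb] sum is convertible to a ring sum over the field [bool], so matrix lemmas apply. *)
  rewrite -[X in is_true X]/(\sum_(i < #|W| | v ord0 i) b (enum_val i) t)%R.
  rewrite big_mkcond /=.
  suff -> : (\sum_(i < #|W|) (if v ord0 i then b (enum_val i) t else 0))%R = 0 :> bool by [].
  rewrite -[RHS]vMt; apply: eq_bigr => i _; rewrite !mxE enum_rankK.
  by case: (v ord0 i).
exists (fun i t => pinvmx M (enum_rank t) (enum_rank_in x0W i)) => i i' iW i'W.
have /matrixP/(_ (enum_rank_in x0W i) (enum_rank_in x0W i')) := mulmxVp freeM.
rewrite !mxE => E.
have -> : (i == i') = (enum_rank_in x0W i == enum_rank_in x0W i').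
  apply/eqP/eqP => [->//|h]; rewrite -(enum_rankK_in x0W iW) h.
  by rewrite enum_rankK_in.
transitivity ((enum_rank_in x0W i == enum_rank_in x0W i')%:R : bool)%R; last first.
  by case: (_ == _).
rewrite -E (reindex (@enum_val T predT)) /=; last first.
  by apply: onW_bij; exact: enum_val_bij.
rewrite -[LHS]/(\sum_(j < #|T|) (b i (enum_val j) &&
  pinvmx M (enum_rank (enum_val j)) (enum_rank_in x0W i')))%R.
by apply: eq_bigr => j _; rewrite !mxE enum_rankK_in // enum_valK.
Qed.

Section Digits.
Variables s N : nat.
Implicit Types (k : Kt s N) (x : 'I_s * 'I_N -> bool) (W : {set Kt s N}).

Definition bitp k (p : 'I_s * 'I_N) : bool := nbit (kval k p.1) p.2.

Definition bdot k x : bool := \big[addb/false]_p (bitp k p && x p).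

(** Linear independence over F_2: the coefficients are 0 or 1, so linear combinations are subset
    sums. *)
Definition indep W : Prop := forall U : {set Kt s N}, U \subset W ->
  U != finset.set0 -> exists p, \big[addb/false]_(k in U) bitp k p.

Lemma bdotE k (F : 'I_s -> 'I_N -> bool) :
  \big[addb/false]_(j < s) \big[addb/false]_(l < N) (nbit (kval k j) l && F j l)
  = bdot k (fun p => F p.1 p.2).
Proof. by rewrite pair_big. Qed.

Lemma eq_bdot k x x' : x =1 x' -> bdot k x = bdot k x'.
Proof. by move=> xx'; apply: eq_bigr => p _; rewrite xx'. Qed.

Lemma bdot_add k x x' : bdot k (fun p => x p (+) x' p) = bdot k x (+) bdot k x'.
Proof. by rewrite -big_split; apply: eq_bigr => p _; rewrite andb_addr. Qed.

Lemma bdot_sum k (I : finType) (P : pred I) (a : I -> bool)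
    (y : I -> 'I_s * 'I_N -> bool) :
  bdot k (fun p => \big[addb/false]_(i | P i) (a i && y i p)) =
  \big[addb/false]_(i | P i) (a i && bdot k (y i)).
Proof.
rewrite /bdot; under eq_bigr do rewrite big_distrr /=.
rewrite exchange_big; apply: eq_bigr => i _; rewrite big_distrr /=.
by apply: eq_bigr => p _; rewrite andbCA.
Qed.

Lemma indep_dual W : indep W -> exists y : Kt s N -> 'I_s * 'I_N -> bool,
  {in W &, forall k k', bdot k (y k') = (k == k')}.
Proof. exact: dual_family. Qed.

Lemma bdot_dual W (y : Kt s N -> 'I_s * 'I_N -> bool) (a : Kt s N -> bool) k :
  {in W &, forall k k', bdot k (y k') = (k == k')} -> k \in W ->
  bdot k (fun p => \big[addb/false]_(i in W) (a i && y i p)) = a k.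
Proof.
move=> yW kW; rewrite bdot_sum (bigD1 k) //= yW // eqxx andbT big1 ?addbF //.
by move=> i /andP[iW /negbTE ik]; rewrite yW // eq_sym ik andbF.
Qed.

Section Sample.
Variable m : nat.
Implicit Types (w : Omega s N m).

Definition colC w (c : 'I_m) : 'I_s * 'I_N -> bool := fun p => w.1.1 p.1 p.2 c.
Definition sgnb k w : bool := bdot k (fun p => w.1.2 p.1 p.2).

Lemma ZkE k w : Zk k w = [forall c, ~~ bdot k (colC w c)].
Proof. by apply: eq_forallb => c; rewrite bdotE. Qed.

Lemma SkE (R : realType) k w : Sk R k w = (-1) ^+ sgnb k w.
Proof. by rewrite /Sk bdotE. Qed.

(** The bits [bdot k (colC w c)], for [k] in [W] and every column [c], are jointly uniform: adding
    dual vectors to the columns translates [phi] by any prescribed [v], so all fibres of [phi] have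
    the same size. The event is the fibre over zero. *)
Lemma card_Zk_indep W : indep W ->
  (#|[set w : Omega s N m | [forall k in W, Zk k w]]%SET| * 2 ^ (#|W| * m))%N
  = #|{: Omega s N m}|.
Proof.
move=> /indep_dual[y yW].
pose phi w : {ffun 'I_#|W| * 'I_m -> bool} :=
  [ffun q => bdot (enum_val q.1) (colC w q.2)].
pose shift (v : {ffun 'I_#|W| * 'I_m -> bool}) w : Omega s N m :=
  ([ffun j => [ffun l => [ffun c => w.1.1 j l c (+)
     \big[addb/false]_(i < #|W|) (v (i, c) && y (enum_val i) (j, l))]]],
   w.1.2, w.2).
have shiftK v : involutive (shift v).
  move=> [[C D] S]; rewrite /shift /=; congr (_, _, _).
  apply/ffunP => j; apply/ffunP => l; apply/ffunP => c.
  by rewrite !ffunE addbK.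
have phi_shift v w : phi (shift v w) = [ffun q => phi w q (+) v q].
  apply/ffunP => -[i c]; rewrite !ffunE /=.
  rewrite (@eq_bdot _ _ (fun p => colC w c p (+)
      \big[addb/false]_(i < #|W|) (v (i, c) && y (enum_val i) p))); last first.
    by case=> j l; rewrite /colC !ffunE.
  rewrite bdot_add; congr (_ (+) _); rewrite bdot_sum (bigD1 i) //=.
  rewrite yW ?enum_valP // eqxx andbT big1 ?addbF // => i' ii'.
  by rewrite yW ?enum_valP // (inj_eq enum_val_inj) eq_sym (negbTE ii') andbF.
pose z : {ffun 'I_#|W| * 'I_m -> bool} := [ffun=> false].
have -> : [set w | [forall k in W, Zk k w]]%SET = [set w | phi w == z]%SET.
  apply/setP => w; rewrite !inE; apply/forall_inP/eqP => [h|h k kW].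
    apply/ffunP => -[i c]; rewrite !ffunE /=; apply/negbTE.
    by have := h _ (enum_valP i); rewrite ZkE => /forallP/(_ c).
  rewrite ZkE; apply/forallP => c.
  have := congr1 (fun g : {ffun _} => g (enum_rank_in kW k, c)) h.
  by rewrite !ffunE /= enum_rankK_in // => ->.
have fib v : #|[set w | phi w == v]%SET| = #|[set w | phi w == z]%SET|.
  rewrite -(card_preimset _ (inv_inj (shiftK v))); apply: eq_card => w.
  rewrite !inE phi_shift; apply/eqP/eqP => [h|->]; last first.
    by apply/ffunP => q; rewrite !ffunE.
  apply/ffunP => q; have := congr1 (fun g : {ffun _} => g q) h; rewrite !ffunE /=.
  by case: (v q); case: bdot.
rewrite -[RHS]sum1_card (partition_big phi predT) //=.
under eq_bigr => v _.
  rewrite (_ : \sum_(_ | _) _ = #|[set w | phi w == z]%SET|)%N; last first.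
    by rewrite -(fib v) -sum1_card; apply: eq_bigl => w; rewrite inE.
  over.
by rewrite sum_nat_const card_ffun card_bool card_prod !card_ord mulnC.
Qed.

Definition Zset w : {set Kt s N} := [set k in QN s N | Zk k w]%SET.

Lemma in_Zset k w : (k \in Zset w) = (k \in QN s N) && Zk k w.
Proof. by rewrite inE. Qed.

Lemma swap_signs : exists flip : Omega s N m -> Omega s N m,
  [/\ involutive flip, forall w, Zset (flip w) = Zset w &
      forall w, indep (Zset w) -> forall k, k \in Zset w ->
        sgnb k (flip w) = w.2 k].
Proof.
(* The dual vectors are a function of the set alone, so that [w] and [flip w], which share [Zset],
   use the same ones. *)
have /boolp.choice[Y HY] : forall W, exists y : Kt s N -> 'I_s * 'I_N -> bool,
    indep W -> {in W &, forall k k', bdot k (y k') = (k == k')}.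
  move=> W; have [/indep_dual[y yW]|nW] := pselect (indep W); first by exists y.
  by exists (fun _ _ => false).
(* d is the discrepancy of the two signs; adding it to both along the dual basis
   exchanges them. *)
pose d w k := [&& k \in Zset w, `[< indep (Zset w) >] & sgnb k w (+) w.2 k].
pose flip w : Omega s N m := (w.1.1,
  [ffun j => [ffun l => w.1.2 j l (+)
      \big[addb/false]_(k in Zset w) (d w k && Y (Zset w) k (j, l))]],
  [ffun k => w.2 k (+) d w k]).
have Zflip w : Zset (flip w) = Zset w.
  by apply/setP => k; rewrite !inE !ZkE.
have sflip w k : indep (Zset w) -> k \in Zset w ->
    sgnb k (flip w) = w.2 k.
  move=> iW kW; rewrite /sgnb.
  rewrite (@eq_bdot _ _ (fun p => w.1.2 p.1 p.2 (+)
      \big[addb/false]_(k in Zset w) (d w k && Y (Zset w) k p))); last first.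
    by case=> j l; rewrite /= !ffunE.
  rewrite bdot_add (bdot_dual _ (HY _ iW)) // -/(sgnb k w) /d kW.
  by rewrite (asboolT iW) /= addKb.
exists flip; split; [move=> w|exact: Zflip|by move=> w iW k; exact: sflip].
(* The discrepancy is symmetric in the two signs, so exchanging them preserves it; a second flip
   then adds the same vectors again and cancels the first. *)
have dflip k : d (flip w) k = d w k.
  rewrite /d Zflip; case kW: (k \in Zset w) => //=.
  case: (pselect (indep (Zset w))) => [iW|iW]; last by rewrite (asboolF iW).
  by rewrite (asboolT iW) /= sflip // !ffunE /d kW (asboolT iW) /= addKb addbC.
have flipD w' j l : (flip w').1.2 j l = w'.1.2 j l (+)
    \big[addb/false]_(k in Zset w') (d w' k && Y (Zset w') k (j, l)).
  by rewrite !ffunE.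
have flipS w' k : (flip w').2 k = w'.2 k (+) d w' k by rewrite ffunE.
have eqD : (flip (flip w)).1.2 = w.1.2.
  apply/ffunP => j; apply/ffunP => l; rewrite !flipD Zflip.
  by under [X in _ (+) X = _]eq_bigr do rewrite dflip; rewrite addbK.
have eqS : (flip (flip w)).2 = w.2.
  by apply/ffunP => k; rewrite !flipS dflip addbK.
have eqC : (flip (flip w)).1.1 = w.1.1 by [].
rewrite [LHS]surjective_pairing [X in (X, _)]surjective_pairing eqC eqD eqS.
by case: w {Zflip dflip eqC eqD eqS} => [[C D] S].
Qed.

End Sample.
End Digits.

(** * Binary digits and bitwise xor *)

Lemma nbit0 n : nbit n 0 = odd n.
Proof. by rewrite /nbit expn0 divn1. Qed.

Lemma nbitS n l : nbit n l.+1 = nbit n./2 l.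
Proof. by rewrite /nbit expnS divnMA divn2. Qed.

Lemma nbit_small n l : (n < 2 ^ l)%N -> nbit n l = false.
Proof. by move=> nl; rewrite /nbit divn_small. Qed.

(** Gives access to bit extensionality and to the specification of [Nat.lxor]. *)
Lemma nbit_testbit n l : nbit n l = Nat.testbit n l.
Proof.
have oddE a : Nat.odd a = odd a.
  elim/ltn_ind: a => -[//|[//|a]] IH; rewrite -[LHS]/(Nat.odd a) IH //=.
  by rewrite negbK.
have halfE a : Nat.div2 a = a./2.
  by elim/ltn_ind: a => -[//|[//|a]] IH /=; rewrite IH.
by elim: l n => [|l IH] n; rewrite ?nbit0 ?nbitS /= ?oddE // halfE IH.
Qed.

Lemma nbit_inj a b : nbit a =1 nbit b -> a = b.
Proof. by move=> ab; apply: PeanoNat.Nat.bits_inj => l; rewrite -!nbit_testbit ab. Qed.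

Lemma nbit_lxor a b l : nbit (Nat.lxor a b) l = nbit a l (+) nbit b l.
Proof.
rewrite !nbit_testbit PeanoNat.Nat.lxor_spec.
by case: (Nat.testbit a l); case: (Nat.testbit b l).
Qed.

Lemma nbit_kval s N (k : Kt s N) j l : (N <= l)%N -> nbit (kval k j) l = false.
Proof.
by move=> Nl; apply: nbit_small; rewrite (leq_trans (ltn_ord _)) // leq_exp2l.
Qed.

Lemma nbit_xorv s N r (t : {ffun 'I_r -> Kt s N}) j l :
  nbit (xorv t j) l = \big[addb/false]_(i < r) nbit (kval (t i) j) l.
Proof.
apply: (big_morph (fun a => nbit a l)) => [a b|]; first exact: nbit_lxor.
by rewrite /nbit div0n.
Qed.

(** * Minimal dependent subsets of Q_N *)

Section Dependent.
Variables s N : nat.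
Implicit Types (k : Kt s N) (U W : {set Kt s N}).

Lemma bitp_eq k (g : 'I_s -> nat) :
  (forall p : 'I_s * 'I_N, bitp k p = nbit (g p.1) p.2) ->
  (forall j l, (N <= l)%N -> nbit (g j) l = false) -> g = kval k.
Proof.
move=> kg g0; apply/boolp.funext => j; apply: nbit_inj => l.
have [Nl|lN] := leqP N l; first by rewrite g0 // nbit_kval.
by rewrite -(kg (j, Ordinal lN)).
Qed.

(** A singleton with zero sum would be the zero vector, which Q_N excludes; a pair with zero sum
    would consist of equal elements. *)
Lemma dependent_card_gt2 U : U \subset QN s N -> U != finset.set0 ->
  (forall p, \big[addb/false]_(k in U) bitp k p = false) -> (2 < #|U|)%N.
Proof.
move=> UQ U0 Up; have := U0; rewrite -card_gt0.
case E : #|U| => [//|[|[|n]]] // _; last 1 first.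
- move/eqP/cards2P: E => [a [b [ab UE]]]; suff ab0 : a = b by rewrite ab0 eqxx in ab.
  have : kval a = kval b.
    apply: bitp_eq => [p|j l]; last exact: nbit_kval.
    have /negbT := Up p; rewrite UE big_setU1 ?inE ?big_set1 //= negb_add.
    by move=> /eqP <-.
  move=> ab'; apply/ffunP => j; apply: val_inj.
  by have := congr1 (fun g : 'I_s -> nat => g j) ab'.
- move/eqP/cards1P: E => [a UE].
  have : a \in QN s N by rewrite (fintype.subsetP UQ) // UE !inE.
  rewrite inE => /andP[/existsP[j]].
  suff -> : kval a = fun=> 0%N by rewrite eqxx.
  apply/esym/bitp_eq => [p|j' l _]; last by rewrite /nbit div0n.
  by have := Up p; rewrite UE big_set1 /nbit div0n.
Qed.

(** With [card_Zk_indep], this is the pairwise independence of the [Zk] behind the variance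
    bound. *)
Lemma indep_card_le2 W : W \subset QN s N -> (#|W| <= 2)%N -> indep W.
Proof.
move=> WQ W2 U UW U0; apply: contrapT => nU.
suff Up p : \big[addb/false]_(k in U) bitp k p = false.
  have := dependent_card_gt2 (fintype.subset_trans UW WQ) U0 Up.
  by rewrite ltnNge (leq_trans (subset_leq_card UW)).
by apply/negbTE/negP => Upt; apply: nU; exists p.
Qed.

Lemma dependent_tuple W : W \subset QN s N -> ~ indep W ->
  exists r (t : {ffun 'I_r -> Kt s N}),
    [/\ (2 <= r < #|W|)%N, injective t, indep [set t i | i : 'I_r]%SET,
        (forall i, t i \in W) & inQ N (xorv t)].
Proof.
move=> WQ nW.
(* Remove one element from a dependent subset of least cardinality. *)
pose dep U := [&& U \subset W, U != finset.set0 &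
  [forall p, ~~ \big[addb/false]_(k in U) bitp k p]].
have [U0 depU0] : exists U, dep U.
  apply: contrapT => ndep; apply: nW => U UW U0; apply: contrapT => nU.
  apply: ndep; exists U; rewrite /dep UW U0 /=; apply/forallP => p.
  by apply/negP => Up; apply: nU; exists p.
have [U /and3P[UW Un0 /forallP Up] minU] := arg_minnP (fun U => #|U|) depU0.
have U3 : (2 < #|U|)%N.
  apply: dependent_card_gt2 => // [|p]; first exact: fintype.subset_trans UW WQ.
  exact/negbTE.
have [k0 k0U] := set0Pn _ Un0.
have cU : #|U| = #|U :\ k0|.+1 by rewrite (cardsD1 k0) k0U.
pose t : {ffun 'I_#|U :\ k0| -> Kt s N} := [ffun i => enum_val i].
have tU i : t i \in U :\ k0 by rewrite ffunE; exact: enum_valP.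
have imt : [set t i | i : 'I_#|U :\ k0|]%SET = U :\ k0.
  apply/setP => k; apply/imsetP/idP => [[i _ ->]//|kU].
  by exists (enum_rank_in kU k); rewrite // ffunE enum_rankK_in.
(* The tuple enumerates [U] without [k0]. It has length [#|U| - 1], hence at least 2 and less than
   [#|W|]. Minimality of [U] makes it independent, and as [U] sums to zero its xor is [k0], which
   lies in Q_N. *)
exists #|U :\ k0|, t; split.
- by rewrite -ltnS -cU U3 (leq_trans _ (subset_leq_card UW)) // cU.
- by move=> i j; rewrite !ffunE => /enum_val_inj.
- rewrite imt => V VU V0; apply: contrapT => nV.
  have : dep V.
    rewrite /dep V0 (fintype.subset_trans VU) /=; last first.
      exact: fintype.subset_trans (subD1set _ _) UW.
    by apply/forallP => p; apply/negP => Vp; apply: nV; exists p.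
  by move/minU; rewrite cU ltnNge subset_leq_card.
- by move=> i; rewrite (fintype.subsetP UW) //; move: (tU i) => /setD1P[].
- have -> : xorv t = kval k0.
    apply: bitp_eq => [p|j l Nl]; last first.
      by rewrite nbit_xorv big1 // => i _; rewrite nbit_kval.
    have := Up p; rewrite (big_setD1 k0) //= negb_add nbit_xorv => /eqP ->.
    rewrite -{1}imt big_imset /=; first by apply: eq_bigl => i; rewrite inE.
    by move=> i j _ _; rewrite !ffunE => /enum_val_inj.
  by have := fintype.subsetP WQ k0 (fintype.subsetP UW k0 k0U); rewrite inE.
Qed.

End Dependent.

(** * The dependence probability *)

Section Probability.
Variables (R : realType) (s N m : nat).
Implicit Types (k : Kt s N) (w : Omega s N m).
Let Om := Omega s N m.

Lemma card_Omega_gt0 : (0 < #|{: Om}|)%N.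
Proof.
by apply/card_gt0P; exists ([ffun=> [ffun=> [ffun=> false]]], [ffun=> [ffun=> false]],
  [ffun=> false]).
Qed.

Lemma mean_Zk_indep (W : {set Kt s N}) : indep W ->
  \sum_(w : Om) ([forall k in W, Zk k w])%:R = #|{: Om}|%:R / 2 ^+ (#|W| * m) :> R.
Proof.
move=> iW; apply/(canRL (mulfK _)); first by rewrite expf_neq0.
rewrite -natrX -(card_Zk_indep m iW) natrM; congr (_ * _).
rewrite -sum1dep_card natr_sum [RHS]big_mkcond /=; apply: eq_bigr => w _.
by case: ifP.
Qed.

Lemma SUM1_swap (f : 'rV[R]_s -> R) w w' : Zset w' = Zset w ->
  (forall k, k \in Zset w -> sgnb k w' = w.2 k) -> SUM1 f w' = SUM1' f w.
Proof.
move=> ZE sE; apply: eq_bigr => k kQ.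
have Zkk : Zk k w' = Zk k w by have /setP/(_ k) := ZE; rewrite !in_Zset kQ.
rewrite Zkk; case kZ : (Zk k w); last by rewrite !mul0r.
by rewrite SkE sE // in_Zset kQ.
Qed.

Lemma dTV_le_dependent (f : 'rV[R]_s -> R) :
  dTV (@SUM1 R s N m f) (@SUM1' R s N m f) <=
  #|[set w : Om | ~~ `[< indep (Zset w) >]]%SET|%:R / #|{: Om}|%:R.
Proof.
have [flip [flipK Zflip sflip]] := swap_signs s N m.
rewrite /dTV; apply: ge_sup.
  by exists `|prob R (@SUM1 R s N m f @^-1` setT) - prob R (@SUM1' R s N m f @^-1` setT)|,
    setT; rewrite //=.
move=> _ [A _ <-].
pose bad := [set w : Om | ~~ `[< indep (Zset w) >]]%SET.
pose P := [set w : Om | `[< A (SUM1 f w) >]]%SET.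
pose P' := [set w : Om | `[< A (SUM1' f w) >]]%SET.
have probE (X : Om -> R) : prob R (X @^-1` A) =
    #|[set w : Om | `[< A (X w) >]]%SET|%:R / #|{: Om}|%:R.
  by rewrite /prob; congr (_%:R / _); apply: eq_card => w; rewrite finset.inE unfold_in asboolb.
rewrite !probE -/P -/P' -/bad -mulrBl normrM [`|_^-1|]ger0_norm ?invr_ge0 //.
rewrite ler_pM2r ?invr_gt0 ?ltr0n ?card_Omega_gt0 //.
(* [flip] preserves [bad] and, outside it, turns one sum into the other. The two events thus differ
   in size only through their parts inside [bad]. *)
have goodE : #|P :\: bad| = #|P' :\: bad|.
  rewrite -(card_preimset _ (inv_inj flipK)); apply: eq_card => w.
  rewrite !inE Zflip !negbK; case: asboolP => //= iW.
  by rewrite (@SUM1_swap f w) // => k; exact: sflip.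
rewrite -(cardsID bad P) -(cardsID bad P') goodE !natrD.
have PI (X : {set Om}) : 0 <= (#|X :&: bad|%:R : R) <= #|bad|%:R.
  by rewrite ler0n ler_nat subset_leq_card // subsetIr.
by rewrite ler_norml; have := PI P; have := PI P'; lra.
Qed.

(** Chebyshev with unnormalized expectations: the variance is at most the mean [mu <= a], and the
    event forces a deviation from [mu] above [a]. *)
Lemma card_Zset_large (a : R) : 0 < a -> #|QN s N|%:R / 2 ^+ m <= a ->
  #|[set w : Om | 2 * a < #|Zset w|%:R]%SET|%:R <= #|{: Om}|%:R / a.
Proof.
move=> a0; set mu := _ / _ => mua.
set n : R := #|{: Om}|%:R.
have mu0 : 0 <= mu by rewrite divr_ge0 // exprn_ge0.
pose X w : R := #|Zset w|%:R.
have XE w : X w = \sum_(k in QN s N) (Zk k w)%:R.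
  rewrite /X -sum1_card natr_sum big_mkcond [RHS]big_mkcond /=.
  by apply: eq_bigr => k _; rewrite in_Zset; case: (k \in _) => //=; case: Zk.
have EZ k : k \in QN s N -> \sum_(w : Om) (Zk k w)%:R = n / 2 ^+ m.
  move=> kQ; have /mean_Zk_indep : indep [set k]%SET.
    by apply: indep_card_le2; rewrite ?cards1 // finset.sub1set.
  rewrite cards1 mul1n => <-; apply: eq_bigr => w _; congr (_%:R).
  congr nat_of_bool; apply/idP/forall_inP => [kw k'|->//]; last by rewrite inE.
  by rewrite inE => /eqP ->.
have EZZ k k' : k \in QN s N -> k' \in QN s N -> k != k' ->
    \sum_(w : Om) (Zk k w)%:R * (Zk k' w)%:R = n / 2 ^+ m / 2 ^+ m.
  move=> kQ k'Q kk'; have /mean_Zk_indep : indep [set k; k']%SET.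
    apply: indep_card_le2; rewrite ?cards2 ?kk' //.
    by apply/fintype.subsetP => x; rewrite in_set2 => /orP[]/eqP ->.
  rewrite cards2 kk' mul2n -addnn exprD invfM mulrA => <-.
  apply: eq_bigr => w _; rewrite -natrM mulnb; congr (_%:R).
  congr nat_of_bool; apply/andP/forall_inP => [[kw k'w] x|h].
    by rewrite in_set2 => /orP[]/eqP ->.
  by split; apply: h; rewrite in_set2 eqxx ?orbT.
have EX : \sum_w X w = mu * n.
  under eq_bigr do rewrite XE.
  rewrite exchange_big /= (eq_bigr _ EZ) sumr_const /mu -mulr_natl; ring.
have EX2 : \sum_w X w ^+ 2 <= mu * n + mu ^+ 2 * n.
  under eq_bigr do rewrite XE expr2 mulr_suml.
  rewrite exchange_big /=.
  suff h (k : Kt s N) : k \in QN s N ->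
      \sum_(w : Om) (Zk k w)%:R * (\sum_(k' in QN s N) (Zk k' w)%:R : R)
      <= n / 2 ^+ m + mu * n / 2 ^+ m.
    rewrite (le_trans (ler_sum _ h)) // sumr_const -[leLHS]mulr_natl /mu.
    by apply/eqP/eqP; rewrite le_eqVlt; apply/orP; left; apply/eqP; ring.
  move=> kQ; under eq_bigr do rewrite mulr_sumr.
  rewrite exchange_big /= (bigD1 k) //= lerD //.
    rewrite -(EZ _ kQ) le_eqVlt; apply/orP; left; apply/eqP/eq_bigr => w _.
    by case: Zk; rewrite ?mulr1 ?mulr0.
  rewrite (eq_bigr (fun=> n / 2 ^+ m / 2 ^+ m)); last first.
    by move=> k' /andP[k'Q k'k]; rewrite EZZ // eq_sym.
  (* The sum over [k' != k] is completed by the nonnegative diagonal term. *)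
  rewrite (_ : mu * n / 2 ^+ m = \sum_(k' in QN s N) (n / 2 ^+ m / 2 ^+ m)).
    rewrite [leRHS](bigD1 k) //= lerDr !divr_ge0 // ?exprn_ge0 //.
  rewrite sumr_const -[RHS]mulr_natl /mu; ring.
have Var : \sum_w (X w - mu) ^+ 2 <= mu * n.
  under eq_bigr do rewrite sqrrB.
  rewrite big_split /= sumrB sumr_const -mulr_natl -/n.
  have -> : \sum_w X w * mu *+ 2 = 2 * mu * (mu * n).
    by rewrite -EX mulr_sumr; apply: eq_bigr => w _; rewrite -mulr_natl; ring.
  by have := EX2; rewrite expr2; lra.
rewrite ler_pdivlMr // -(ler_pM2r a0); apply: (@le_trans _ _ (mu * n)); last first.
  by rewrite mulrC ler_wpM2l // ler0n.
rewrite (le_trans _ Var) // -mulrA -sum1dep_card natr_sum mulr_suml.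
rewrite big_mkcond; apply: ler_sum => w _; case: ifP => [Xa|_]; last exact: sqr_ge0.
by rewrite mul1r -expr2 ler_sqr ?nnegrE ?ltW //; move: Xa; rewrite -/(X w); lra.
Qed.

(** Union bound over the tuples of [dependent_tuple]. Injectivity and independence of a tuple make
    its [r] events [Zk] hold jointly with probability exactly [2 ^ (- r m)]; both conditions are
    then dropped to count the tuples by [xor_prob]. *)
Lemma card_dependent_small (K : nat) :
  #|[set w : Om | ~~ `[< indep (Zset w) >] && (#|Zset w| <= K)%N]%SET|%:R <=
  #|{: Om}|%:R *
  \sum_(2 <= r < K) xor_prob R s N r * (#|QN s N|%:R / 2 ^+ m) ^+ r.
Proof.
pose XP r := [set t : {ffun 'I_r -> Kt s N} |
  [forall i, t i \in QN s N] && inQ N (xorv t)]%SET.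
pose good r (t : {ffun 'I_r -> Kt s N}) :=
  [&& t \in XP r, injectiveb t & `[< indep [set t i | i : 'I_r]%SET >]].
pose Zt r (t : {ffun 'I_r -> Kt s N}) (w : Om) := [forall i, Zk (t i) w].
have step1 : #|[set w : Om | ~~ `[< indep (Zset w) >] && (#|Zset w| <= K)%N]%SET|%:R
    <= \sum_(w : Om) \sum_(2 <= r < K) \sum_(t | good r t) (Zt r t w)%:R :> R.
  rewrite -sum1dep_card natr_sum big_mkcond; apply: ler_sum => w _.
  have sum0 r : 0 <= \sum_(t | good r t) (Zt r t w)%:R :> R by exact: sumr_ge0.
  case: ifP => [/andP[/asboolPn nW WK]|_]; last exact: sumr_ge0.
  have WQ : Zset w \subset QN s N.
    by apply/fintype.subsetP => k; rewrite in_Zset => /andP[].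
  have [r [t [/andP[r2 rW] tinj tind tW tQ]]] := dependent_tuple WQ nW.
  rewrite (@bigD1_seq _ _ _ _ _ r) ?iota_uniq ?mem_index_iota ?r2 ?(leq_trans rW) //=.
  rewrite (bigD1 t) /=; last first.
    rewrite /good inE tQ andbT; apply/and3P; split; last exact/asboolP.
      by apply/forallP => i; apply: (fintype.subsetP WQ).
    exact/injectiveP.
  have -> : Zt r t w.
    by apply/forallP => i; have := tW i; rewrite in_Zset => /andP[].
  by rewrite -addrA -[leLHS]addr0 lerD // addr_ge0 //; apply: sumr_ge0 => // i _;
    exact: sum0.
rewrite (le_trans step1) // exchange_big /= mulr_sumr.
apply: ler_sum_nat => r _; rewrite exchange_big /=.
have EZt t : good r t -> \sum_w (Zt r t w)%:R = #|{: Om}|%:R / 2 ^+ (r * m) :> R.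
  move=> /and3P[_ /injectiveP tinj /asboolP tind].
  have := mean_Zk_indep tind; rewrite card_imset // card_ord => <-.
  apply: eq_bigr => w _; congr (nat_of_bool _)%:R.
  apply/forallP/forall_inP => [h _ /imsetP[i _ ->]//|h i].
  by apply: h; apply: imset_f.
rewrite (eq_bigr _ EZt) sumr_const -[leLHS]mulr_natl.
rewrite [leRHS]mulrCA mulrC [X in _ <= X]mulrC -[leLHS]mulrA -[leRHS]mulrA.
rewrite ler_wpM2l //.
rewrite mulrC [leRHS]mulrC expr_div_n -exprM [(m * r)%N]mulnC mulrA.
rewrite ler_wpM2r ?invr_ge0 ?exprn_ge0 //.
have XPE : xor_prob R s N r = #|XP r|%:R / #|QN s N|%:R ^+ r.
  rewrite /xor_prob natrX; congr (_%:R / _); apply: eq_card => t.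
  by rewrite finset.inE unfold_in asboolb.
(* If the denominator of [xor_prob] vanishes, then Q_N is empty and there is no good tuple. *)
have [Q0|Q0] := eqVneq (#|QN s N|%:R ^+ r : R) 0.
  have -> : #|good r| = 0%N.
    apply/eqP; rewrite -leqn0 leqNgt; apply/negP => /card_gt0P[t /andP[]].
    rewrite inE => /andP[/forallP tQ _] _; move/eqP: Q0; apply/negP.
    rewrite expf_eq0 pnatr_eq0 cards_eq0 negb_and -lt0n orbC; apply/orP.
    clear -tQ; case: r t tQ => [|r] t tQ; first by right.
    by left; apply/set0Pn; exists (t ord0).
  by rewrite Q0 mulr0.
rewrite XPE divfK // ler_nat subset_leq_card //.
by apply/fintype.subsetP => t /andP[].
Qed.

End Probability.

(** * The size of Q_N *)

Section Counting.

(** The defining sum stops at [a], not at [L]; zero bits extend both ranges to [maxn L a]. *)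
Lemma digit_weightE a L : (a < 2 ^ L)%N ->
  digit_weight a = (\sum_(0 <= l < L) nbit a l * l.+1)%N.
Proof.
have trunc K M : (a < 2 ^ K)%N -> (K <= M)%N ->
    (\sum_(0 <= l < M) nbit a l * l.+1 = \sum_(0 <= l < K) nbit a l * l.+1)%N.
  move=> aK KM; rewrite (@big_cat_nat _ _ _ K) //= -[RHS]addn0; congr (_ + _)%N.
  rewrite big_nat_cond big1 // => l /andP[/andP[Kl _] _].
  by rewrite nbit_small // (leq_trans aK) // leq_exp2l.
move=> aL; rewrite -(trunc _ _ aL (leq_maxl L a)).
rewrite (trunc a (maxn L a) (ltn_expl a (ltnSn 1)) (leq_maxr L a)).
by rewrite big_mkord.
Qed.

Lemma digit_weight0 : digit_weight 0 = 0%N.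
Proof. by rewrite /digit_weight big_ord0. Qed.

Lemma digit_weightD b L : (b < 2 ^ L)%N ->
  digit_weight (b + 2 ^ L) = (digit_weight b + L.+1)%N.
Proof.
move=> bL; rewrite (@digit_weightE _ L.+1); last by rewrite expnS mul2n -addnn ltn_add2r.
rewrite big_nat_recr //= (digit_weightE bL); congr (_ + _)%N.
  apply: eq_big_nat => l /andP[_ lL]; congr (nat_of_bool _ * _)%N.
  rewrite /nbit divnDr ?dvdn_exp2l ?(ltnW lL) // -expnB ?(ltnW lL) // oddD.
  by rewrite oddX subn_eq0 leqNgt lL addbF.
by rewrite /nbit divnDr // divn_small // divnn expn_gt0 mul1n.
Qed.

(** The upper half of the range below [2 ^ L.+1] is the lower half with bit [L] set, which
    contributes the factor [x ^+ L.+1]. *)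
Lemma sum_digit_weight (R : comNzRingType) (x : R) L :
  \sum_(0 <= a < 2 ^ L) x ^+ digit_weight a = \prod_(0 <= l < L) (1 + x ^+ l.+1).
Proof.
elim: L => [|L IH]; first by rewrite expn0 big_nat1 big_geq // digit_weight0 expr0.
rewrite big_nat_recr //= -IH mulrDr mulr1.
rewrite expnS mul2n -addnn (@big_cat_nat _ _ _ (2 ^ L)) ?leq_addr //=; congr (_ + _).
rewrite -{1}[(2 ^ L)%N]add0n big_addn addnK mulr_suml; apply: eq_big_nat => a /andP[_ aL].
by rewrite digit_weightD // exprD.
Qed.

(** Rankin's trick: as [x <= 1], each element of Q_N contributes at least [x ^+ N] to the generating
    function, which factors over the [s] coordinates. *)
Lemma card_QN_le (R : realType) s N (x : R) : 0 < x -> x <= 1 ->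
  #|QN s N|%:R * x ^+ N <= (\prod_(0 <= l < N) (1 + x ^+ l.+1)) ^+ s.
Proof.
move=> x0 x1; rewrite -sum_digit_weight big_mkord.
have -> (y : R) : y ^+ s = \prod_(j < s) y by rewrite prodr_const card_ord.
rewrite bigA_distr_bigA /= -sum1_card natr_sum mulr_suml big_mkcond /=.
apply: ler_sum => k _; case: ifP => [|_]; last first.
  by rewrite prodr_ge0 // => i _; rewrite exprn_ge0 // ltW.
rewrite inE => /andP[_ kN]; rewrite mul1r -expr_sum.
by apply: ler_wiXn2l => //; exact: ltW.
Qed.

(** Numbers below [2 ^ n] placed in the first coordinate have at most [n] digits, each of weight at
    most [n]. The successor accounts for the zero vector. *)
Lemma card_QN_ge s N n : (0 < s)%N -> (n * n <= N)%N -> (2 ^ n <= #|QN s N|.+1)%N.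
Proof.
case: s => // s _ nN.
have nN' : (n <= N)%N by rewrite (leq_trans _ nN) //; case: n {nN} => // n; rewrite leq_pmulr.
have lt2 (a : 'I_(2 ^ n)) : (a < 2 ^ N)%N by rewrite (leq_trans (ltn_ord a)) // leq_exp2l.
have pN : (0 < 2 ^ N)%N by rewrite expn_gt0.
pose g (a : 'I_(2 ^ n)) : Kt s.+1 N :=
  [ffun j => if j == ord0 then Ordinal (lt2 a) else Ordinal pN].
have ginj : injective g.
  move=> a b /(congr1 (fun h : Kt s.+1 N => nat_of_ord (h ord0))).
  by rewrite !ffunE /= => /val_inj.
pose z : 'I_(2 ^ n) := Ordinal (expn_gt0 2 n : (0 < 2 ^ n)%N).
rewrite -[X in (X <= _)%N]card_ord -(card_imset predT ginj).
have -> : #|[set g x | x in predT]%SET| = #|(g z |: [set g a | a in predT & a != z])%SET|.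
  apply: eq_card => k; rewrite in_setU1; apply/imsetP/orP => [[a _ ->]|].
    have [->|az] := eqVneq a z; [by left|right].
    by apply/imsetP; exists a; rewrite ?inE.
  by case=> [/eqP ->|/imsetP[a _ ->]]; [exists z|exists a].
rewrite cardsU1 -[leqRHS]add1n leq_add ?leq_b1 // subset_leq_card //.
apply/fintype.subsetP => _ /imsetP[a + ->]; rewrite !inE /= => az.
apply/andP; split.
  apply/existsP; exists ord0; rewrite /kval ffunE /=.
  by apply: contra az => /eqP a0; apply/eqP/val_inj.
rewrite /kweight big_ord_recl big1 ?addn0; last first.
  by move=> i _; rewrite /kval ffunE /= digit_weight0.
rewrite /kval ffunE /= (digit_weightE (ltn_ord a)) (leq_trans _ nN) //.
rewrite big_mkord (_ : n * n = \sum_(l < n) n)%N; last by rewrite sum_nat_const card_ord.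
rewrite leq_sum // => l _.
by case: nbit; rewrite ?mul1n // ltn_ord.
Qed.

End Counting.

(** * The bound zeta(2) <= pi^2 / 6 *)

Section Basel.
Variable R : realType.

Lemma sin_le_id (x : R) : 0 <= x -> sin x <= x.
Proof.
move=> x0; have [|c _] := @MVT_segment R sin cos 0 x x0.
  by apply: continuous_subspaceT => z; exact: continuous_sin.
rewrite sin0 !subr0 => ->.
by rewrite -[leRHS]mul1r ler_wpM2r // cos_le1.
Qed.

Lemma inv_sin2_half (x : R) : 0 < x -> x < pi ->
  (sin x ^+ 2)^-1 = 4^-1 * ((sin (x / 2) ^+ 2)^-1 + (sin ((pi - x) / 2) ^+ 2)^-1).
Proof.
move=> x0 xpi.
have sE : sin ((pi - x) / 2) = cos (x / 2).
  by rewrite mulrBl sinB sin_pihalf cos_pihalf mul1r mul0r subr0.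
have h0 : 0 < x / 2 by lra.
have hpi : x / 2 < pi / 2 by lra.
have s0 : sin (x / 2) != 0 by rewrite gt_eqF // sin_gt0_pihalf // h0.
have c0 : cos (x / 2) != 0 by rewrite gt_eqF // cos_gt0_pihalf // hpi andbT; lra.
have -> : sin x = 2 * (cos (x / 2) * sin (x / 2)).
  by rewrite mulr_natl -sin_mulr2n -mulr_natl; congr sin; field.
rewrite sE; have := cos2Dsin2 (x / 2).
move: (cos _) (sin _) c0 s0 => c t c0 t0 ct.
transitivity (4^-1 * (c ^+ 2 + t ^+ 2) / (c ^+ 2 * t ^+ 2)).
  by rewrite ct; field; rewrite c0 t0.
by field; rewrite c0 t0.
Qed.

Lemma sum_upper_half M (F : nat -> R) :
  \sum_(M <= i < M + M) F i = \sum_(0 <= i < M) F (M + M - i.+1)%N.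
Proof.
rewrite big_nat_rev /= -{1}[M]add0n big_addn addnK.
by apply: eq_big_nat => i _; congr F; lia.
Qed.

(* Hofbauer's argument: halving the angle replaces each term by two, and the
   index reflection sends the second kind to the upper half of the range. *)
Lemma sum_inv_sin2 n :
  \sum_(0 <= k < 2 ^ n) (sin (k.*2.+1%:R * pi / 2 ^+ n.+2) ^+ 2)^-1 = 2 * 4 ^+ n :> R.
Proof.
elim: n => [|n IH].
  rewrite expn0 big_nat1 mul1r expr0 mulr1 (_ : pi / 2 ^+ 2 = pi / 2 / 2); last by field.
  have /= := @inv_sin2_half (pi / 2); have := @pi_gt0 R.
  rewrite (_ : pi - pi / 2 = pi / 2); last by field.
  rewrite sin_pihalf expr1n invr1 => pi0 /(_ ltac:(lra) ltac:(lra)).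
  by move: (sin _ ^+ 2)^-1 => u; lra.
rewrite [4 ^+ _]exprS mulrCA -IH expnS mul2n -addnn (@big_cat_nat _ _ _ (2 ^ n)) ?leq_addr //=.
rewrite mulr_sumr sum_upper_half -big_split /=.
apply: eq_big_nat => k /andP[_ kn].
set x := _ / 2 ^+ n.+2.
have p0 := @pi_gt0 R.
have e0 : (0 : R) < 2 ^+ n.+2 by rewrite exprn_gt0.
have x0 : 0 < x by rewrite divr_gt0 // mulr_gt0.
have xpi : x < pi.
  rewrite ltr_pdivrMr // mulrC ltr_pM2l // -natrX ltr_nat.
  by rewrite !expnS; lia.
rewrite (inv_sin2_half x0 xpi) mulrA mulfV ?pnatr_eq0 // mul1r.
congr ((sin _ ^+ 2)^-1 + (sin _ ^+ 2)^-1).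
  by rewrite /x [in LHS]exprS; field; rewrite gt_eqF.
rewrite /x [in LHS]exprS.
have -> : ((2 ^ n + 2 ^ n - k.+1).*2.+1)%N = (2 ^ n.+2 - k.*2.+1)%N.
  by rewrite !expnS; lia.
rewrite natrB; last by rewrite !expnS; lia.
rewrite natrX; move: (2 ^+ n.+2) e0 => y e0. by field; rewrite gt_eqF.
Qed.

(** Termwise [sin x <= x] in [sum_inv_sin2], at the angles [x = (2k+1) pi / 2^(n+2)]; the scaling
    factor turns [(2k+1)^-2] into [x^-2]. *)
Lemma sum_inv_odd2_le n :
  \sum_(0 <= k < 2 ^ n) (k.*2.+1%:R ^+ 2)^-1 <= pi ^+ 2 / 8 :> R.
Proof.
have p0 := @pi_gt0 R.
have q0 : 0 < 4 ^+ n * 16 / pi ^+ 2 :> R.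
  by rewrite divr_gt0 ?exprn_gt0 // mulr_gt0 // exprn_gt0.
rewrite -(ler_pM2l q0) (_ : _ * (pi ^+ 2 / 8) = 2 * 4 ^+ n); last first.
  by move: pi p0 {q0} => p p0; field; rewrite gt_eqF.
rewrite -sum_inv_sin2 mulr_sumr; apply: ler_sum_nat => k /andP[_ kn].
set x := _ / 2 ^+ n.+2.
have e0 : (0 : R) < 2 ^+ n.+2 by rewrite exprn_gt0.
have x0 : 0 < x by rewrite divr_gt0 // mulr_gt0.
have xpi : x < pi.
  rewrite ltr_pdivrMr // mulrC ltr_pM2l // -natrX ltr_nat.
  by rewrite !expnS; lia.
have -> : 4 ^+ n * 16 / pi ^+ 2 * (k.*2.+1%:R ^+ 2)^-1 = (x ^+ 2)^-1 :> R.
  rewrite /x (_ : 4 ^+ n * 16 = (2 ^+ n.+2) ^+ 2); last first.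
    rewrite -exprM mulnC exprM (_ : 2 ^+ 2 = 4 :> R); last by ring.
    by rewrite !exprS; ring.
  move: (2 ^+ n.+2) e0 {x x0 xpi} => y y0; move: pi {q0} p0 => p p0.
  by field; rewrite !gt_eqF // pnatr_eq0.
have s0 : 0 < sin x by rewrite sin_gt0_pi // x0.
rewrite lef_pV2 ?posrE ?exprn_gt0 // ler_sqr ?nnegrE; last exact: ltW.
  exact/sin_le_id/ltW.
exact: ltW.
Qed.

Lemma sum_inv2_le K : \sum_(0 <= n < K) (n.+1%:R ^+ 2)^-1 <= pi ^+ 2 / 6 :> R.
Proof.
have mono (K1 K2 : nat) : (K1 <= K2)%N ->
    \sum_(0 <= n < K1) (n.+1%:R ^+ 2)^-1 <= \sum_(0 <= n < K2) (n.+1%:R ^+ 2)^-1 :> R.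
  move=> K12; rewrite [leRHS](@big_cat_nat _ _ _ K1) //= lerDl sumr_ge0 //.
rewrite (le_trans (mono _ _ (ltnW (ltn_expl K (ltnSn 1))))) //.
(* With E(K) the partial sum, E(K) <= E(2K) <= pi^2 / 8 + E(K) / 4. *)
have split2 M : \sum_(0 <= n < M.*2) (n.+1%:R ^+ 2)^-1 =
    \sum_(0 <= k < M) (k.*2.+1%:R ^+ 2)^-1 + 4^-1 * \sum_(0 <= n < M) (n.+1%:R ^+ 2)^-1 :> R.
  elim: M => [|M IH]; first by rewrite !big_geq // mulr0 addr0.
  have E : M.*2.+2%:R = 2 * M.+1%:R :> R by rewrite -natrM; congr _%:R; lia.
  rewrite doubleS !big_nat_recr //= IH E exprMn.
  rewrite (_ : 2 ^+ 2 = 4 :> R); last by ring.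
  by rewrite [(4 * _)^-1]invfM; ring.
have := mono (2 ^ K)%N (2 ^ K).*2 ltac:(by rewrite -addnn leq_addr).
by rewrite split2; have := sum_inv_odd2_le K; lra.
Qed.

End Basel.

(** * Euler's product and the exponential bound on Q_N *)

Section EulerProduct.
Variable R : realType.

(** The derivative of the difference is the square of [e^(x/2) - e^(-x/2)]. *)
Lemma sinh_ge_id (u : R) : 0 <= u -> 2 * u <= expR u - expR (- u).
Proof.
move=> u0; pose f x : R := expR x - expR (- x) - 2 * x.
have df (x : R) : is_derive x 1 f (expR x + expR (- x) - 2).
  rewrite /f; apply: is_derive_eq.
  by rewrite !scaler1 /GRing.scale /=; ring.
have [|c _] := @MVT_segment R f _ 0 u u0 (fun x _ => df x).
  apply: continuous_subspaceT => z; apply: differentiable_continuous.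
  exact/derivable1_diffP.
rewrite {1 2}/f !(oppr0, mulr0, subr0, expR0, subrr, addr0) => fE.
suff : 0 <= (expR c + expR (- c) - 2) * u by rewrite -fE; lra.
rewrite mulr_ge0 //; have pq := expRxMexpNx_1 (c / 2).
have -> : expR c = expR (c / 2) ^+ 2 by rewrite -expRM_natl; congr expR; field.
have -> : expR (- c) = expR (- (c / 2)) ^+ 2 by rewrite -expRM_natl; congr expR; field.
by have := sqr_ge0 (expR (c / 2) - expR (- (c / 2))); lra.
Qed.

(** Two geometric series: for [|u| < 1] the full sums give [1/(1-u) - 2u/(1-u^2) = 1/(1+u)], and the
    subtracted fraction is the tail. *)
Lemma sum_poly_eq (u : R) M : u != 1 -> u != -1 ->
  \sum_(0 <= n < M) (u ^+ n - 2 * u ^+ n.*2.+1) =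
  (1 + u)^-1 - u ^+ M * (1 + u - 2 * u ^+ M.+1) / (1 - u ^+ 2).
Proof.
move=> u1 uN1.
have d0 : 1 - u != 0 by rewrite subr_eq0 eq_sym.
have d1 : 1 + u != 0 by rewrite addrC -(opprK 1) subr_eq0.
have d2 : 1 - u ^+ 2 != 0.
  by rewrite (_ : 1 - u ^+ 2 = (1 - u) * (1 + u)) ?mulf_neq0 //; ring.
elim: M => [|M IH]; first by rewrite big_geq // expr0 expr1; field; rewrite d1 d2.
rewrite big_nat_recr //= IH !exprS -addnn exprD; field.
by rewrite d1 d2.
Qed.

(* Truncation of the expansion of ln (1 + y) = ln (1 - y^2) - ln (1 - y), which
   is Euler's identity and avoids the alternating series. *)
Lemma ln1D_le (y : R) M : 0 < y -> y < 1 ->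
  ln (1 + y) <= \sum_(0 <= n < M) (y ^+ n.+1 - (y ^+ n.+1) ^+ 2) / n.+1%:R
                + y ^+ M / (1 - y).
Proof.
move=> y0 y1.
pose g n (x : R) : R := (x ^+ n.+1 - (x ^+ n.+1) ^+ 2) / n.+1%:R.
pose f : R -> R := (fun x => ln (1 + x)) - \sum_(n < M) g n.
pose df (x : R) := (1 + x)^-1 - \sum_(0 <= n < M) (x ^+ n - 2 * x ^+ n.*2.+1).
have dg n (x : R) : is_derive x 1 (g n) (x ^+ n - 2 * x ^+ n.*2.+1).
  have -> : g n = n.+1%:R^-1 \*: ((id : R -> R) ^+ n.+1 - (id ^+ n.+1) ^+ 2).
    by apply/boolp.funext => z; rewrite /g mulrC /= !exprfctE.
  apply: is_derive_eq.
  rewrite !exprfctE /GRing.scale /= !mulr1 expr1 -addnn !exprS exprD.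
  have := @pnatr_eq0 R n.+1; move: (x ^+ n) n.+1%:R => u k /negbT k0.
  by field.
have dfE (x : R) : -1 < x -> is_derive x 1 f (df x).
  move=> x1; rewrite /f /df; apply: is_deriveB.
    have x10 : 0 < 1 + x by lra.
    have /(is_derive1_comp (is_derive1_ln x10)) : is_derive x 1 (fun z : R => 1 + z) (0 + 1).
      exact: is_deriveD.
    by rewrite add0r mulr1.
  rewrite big_mkord; exact: is_derive_sum.
have [||c] := @MVT R f df 0 y y0.
- by move=> z; rewrite in_itv /= => /andP[z0 _]; apply: dfE; lra.
- apply: derivable_within_continuous => z; rewrite in_itv /= => /andP[z0 _].
  by have := dfE z ltac:(lra) => /@ex_derive.
rewrite in_itv /= => /andP[c0 cy].
have fE x : f x = ln (1 + x) - \sum_(0 <= n < M) g n x.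
  by rewrite big_mkord -[LHS]/(ln (1 + x) - (\sum_(n < M) g n) x) fct_sumE.
rewrite !fE addr0 ln1 [X in _ - (_ - X)]big1; last first.
  by move=> n _; rewrite /g expr0n /= expr0n subrr mul0r.
rewrite !subr0 => E.
(* By [sum_poly_eq], [df c] is exactly the tail of the differentiated series. *)
have : df c * y <= y ^+ M / (1 - y).
  rewrite /df sum_poly_eq; [|lra|lra].
  rewrite opprB addrC subrK.
  have cM : c ^+ M <= y ^+ M by rewrite lerXn2r ?nnegrE //; lra.
  have cM0 : 0 <= c ^+ M by rewrite exprn_ge0 //; lra.
  have cM10 : 0 <= c ^+ M.+1 by rewrite exprn_ge0 //; lra.
  have c2 : 1 - c ^+ 2 = (1 - c) * (1 + c) by ring.
  have q0 : 0 < 1 - c ^+ 2 by rewrite c2 mulr_gt0 //; lra.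
  have le1 : c ^+ M * (1 + c - 2 * c ^+ M.+1) / (1 - c ^+ 2) <= y ^+ M / (1 - y).
    apply: (@le_trans _ _ (y ^+ M * (1 + c) / (1 - c ^+ 2))).
      rewrite ler_pM2r ?invr_gt0 //; apply: (@le_trans _ _ (c ^+ M * (1 + c))).
        by rewrite ler_wpM2l //; lra.
      by rewrite ler_wpM2r //; lra.
    have -> : y ^+ M * (1 + c) / (1 - c ^+ 2) = y ^+ M / (1 - c).
      rewrite c2; move: (y ^+ M) => u; field.
      by apply/andP; split; apply/eqP; lra.
    by rewrite ler_wpM2l ?exprn_ge0 ?lef_pV2 ?posrE //; lra.
  apply: (@le_trans _ _ (y ^+ M / (1 - y) * y)); first by rewrite ler_wpM2r //; lra.
  by rewrite ler_piMr ?divr_ge0 ?exprn_ge0 //; lra.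
by rewrite -E lerBlDl.
Qed.

(** The bound is the infinite sum [z/(1-z) - z^2/(1-z^2)]; the finite sum times [1 - z^2] factors as
    [(1 - z^L)(z - z^(L+2))]. *)
Lemma sum_geom_sub_sq_le (z : R) L : 0 < z -> z < 1 ->
  \sum_(0 <= l < L) (z ^+ l.+1 - (z ^+ l.+1) ^+ 2) <= z / (1 - z ^+ 2).
Proof.
move=> z0 z1; have z2 : z ^+ 2 < 1 by rewrite expr_lt1 // ltW.
rewrite ler_pdivlMr; last by lra.
have -> : (\sum_(0 <= l < L) (z ^+ l.+1 - (z ^+ l.+1) ^+ 2)) * (1 - z ^+ 2) =
    (1 - z ^+ L) * (z - z ^+ L.+2).
  elim: L => [|L IH]; first by rewrite big_geq // expr0 subrr !mul0r.
  by rewrite big_nat_recr //= mulrDl IH !exprS; ring.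
have zL : 0 <= z ^+ L <= 1.
  by rewrite exprn_ge0 ?exprn_ile1 //; exact: ltW.
have zL2 : 0 <= z ^+ L.+2 <= z.
  by rewrite exprn_ge0 ?[leRHS](esym (expr1 z)) ?ler_wiXn2l //; exact: ltW.
rewrite -[leRHS]mul1r ler_pM //; lra.
Qed.

(** Expand each logarithm and exchange the sums. With [u = t (n+1)], the inner sum is at most
    [1 / (2 sinh u) <= 1 / (2u)], and the Basel bound finishes. *)
Lemma sum_ln1D_expR_le (t : R) L : 0 < t ->
  \sum_(0 <= l < L) ln (1 + expR (- t) ^+ l.+1) <= pi ^+ 2 / (12 * t).
Proof.
move=> t0; set y := expR (- t).
have y0 : 0 < y by exact: expR_gt0.
have y1 : y < 1 by rewrite expR_lt1 oppr_lt0.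
apply/ler_addgt0Pr => e e0.
(* The [L] truncation errors together cost at most [e]. Dividing by [L.+1] covers [L = 0]. *)
have [M yM] : exists M, L%:R * (y ^+ M / (1 - y)) <= e.
  have d0 : 0 < e * (1 - y) / L.+1%:R by rewrite divr_gt0 // mulr_gt0 //; lra.
  have ny1 : `|y| < 1 by rewrite ger0_norm // ltW.
  have /cvgrPdist_lt/(_ _ d0)[M _ /(_ M (leqnn M))] := cvg_expr ny1.
  rewrite /= sub0r normrN ger0_norm ?exprn_ge0 ?ltW // ltr_pdivlMr // => yM.
  exists M; rewrite mulrA ler_pdivrMr; last by lra.
  have := exprn_ge0 M (ltW y0); move: yM; rewrite -natr1 mulrC; lra.
have step l : (0 <= l < L)%N -> ln (1 + y ^+ l.+1) <=
    \sum_(0 <= n < M) ((y ^+ n.+1) ^+ l.+1 - ((y ^+ n.+1) ^+ l.+1) ^+ 2) / n.+1%:R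
      + y ^+ M / (1 - y).
  move=> _; have yl0 : 0 < y ^+ l.+1 by rewrite exprn_gt0.
  have yly : y ^+ l.+1 <= y.
    by rewrite -[leRHS]expr1 ler_wiXn2l //; exact: ltW.
  apply: (le_trans (@ln1D_le (y ^+ l.+1) M yl0 (le_lt_trans yly y1))).
  apply: lerD.
    by apply: ler_sum_nat => n _; rewrite [y ^+ _ ^+ _]exprAC.
  apply: ler_pM; rewrite ?exprn_ge0 ?invr_ge0 ?lerXn2r ?nnegrE ?lef_pV2 ?posrE //; lra.
rewrite (le_trans (ler_sum_nat step)) // big_split /= sumr_const_nat subn0.
rewrite -[X in _ + X]mulr_natl lerD // exchange_big /=.
have bound n : (0 <= n < M)%N ->
    \sum_(0 <= l < L) ((y ^+ n.+1) ^+ l.+1 - ((y ^+ n.+1) ^+ l.+1) ^+ 2) / n.+1%:R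
    <= (2 * t)^-1 * (n.+1%:R ^+ 2)^-1.
  move=> _; have n0 : 0 < n.+1%:R :> R by [].
  have z0 : 0 < y ^+ n.+1 by rewrite exprn_gt0.
  have z1 : y ^+ n.+1 < 1 by rewrite exprn_ilt1 // ltW.
  have u0 : 0 < t * n.+1%:R by rewrite mulr_gt0.
  rewrite -mulr_suml (_ : _ * _ = (2 * (t * n.+1%:R))^-1 / n.+1%:R); last first.
    by move: n.+1%:R n0 {u0} => k k0; field; rewrite !gt_eqF.
  rewrite ler_pM2r ?invr_gt0 // (le_trans (sum_geom_sub_sq_le _ z0 z1)) //.
  have z2 : (y ^+ n.+1) ^+ 2 < 1 by rewrite expr_lt1 // ltW.
  rewrite ler_pdivrMr; last by lra.
  rewrite mulrC ler_pdivlMr; last by lra.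
  have zE : y ^+ n.+1 = expR (- (t * n.+1%:R)) by rewrite -expRM_natr mulNr.
  have := sinh_ge_id (ltW u0); have := expRxMexpNx_1 (t * n.+1%:R).
  rewrite -zE => ez /(ler_wpM2l (ltW z0)); rewrite mulrBr [_ * expR _]mulrC ez -expr2.
  by lra.
rewrite (le_trans (ler_sum_nat bound)) // -mulr_sumr.
have -> : pi ^+ 2 / (12 * t) = (2 * t)^-1 * (pi ^+ 2 / 6) :> R.
  by field; rewrite gt_eqF.
by rewrite ler_wpM2l ?sum_inv2_le // invr_ge0; lra.
Qed.

Lemma card_QN_le_expR s N (a q : R) : 0 < a -> 0 < q -> a ^+ 2 = N%:R ->
  s%:R * pi ^+ 2 * q ^+ 2 = 3 * ln 2 ^+ 2 ->
  #|QN s N|%:R <= expR (a * ln 2 / q).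
Proof.
move=> a0 q0 aN qE; have l0 : 0 < ln 2 :> R by rewrite ln_gt0 // ltr1n.
(* minimizes a^2 t + s pi^2 / (12 t) *)
pose t : R := ln 2 / (2 * q * a).
have t0 : 0 < t by rewrite divr_gt0 // !mulr_gt0.
have x0 := expR_gt0 (- t).
have x1 : expR (- t) <= 1 by rewrite expR_le1 oppr_le0 ltW.
have prodE : \prod_(0 <= l < N) (1 + expR (- t) ^+ l.+1) <= expR (pi ^+ 2 / (12 * t)).
  rewrite (eq_bigr (fun l => expR (ln (1 + expR (- t) ^+ l.+1)))); last first.
    by move=> l _; rewrite lnK // posrE addr_gt0 // exprn_gt0.
  by rewrite -expR_sum ler_expR sum_ln1D_expR_le.
have := @card_QN_le R s N _ x0 x1; rewrite -ler_pdivlMr ?exprn_gt0 // => /le_trans; apply.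
have -> : expR (a * ln 2 / q) = expR (pi ^+ 2 / (12 * t)) ^+ s / expR (- t) ^+ N.
  rewrite -!expRM_natl -expRN -expRD; congr expR.
  (* At the chosen [t] this term equals the other one, [a^2 t], so the exponent is twice their
     common value. *)
  have -> : s%:R * (pi ^+ 2 / (12 * t)) = ln 2 * a / (2 * q).
    rewrite (_ : _ * _ = s%:R * pi ^+ 2 * q ^+ 2 * (a / (6 * q * ln 2))); last first.
      rewrite /t; move: (ln 2) l0 (pi : R) => l l0 p.
      by field; rewrite !gt_eqF.
    rewrite qE; move: (ln 2) l0 => l l0.
    by field; rewrite !gt_eqF.
  rewrite -aN /t; move: (ln 2) l0 => l l0.
  by field; rewrite !gt_eqF.
rewrite ler_pM2r ?invr_gt0 ?exprn_gt0 // lerXn2r ?nnegrE ?expR_ge0 //.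
by rewrite prodr_ge0 // => l _; rewrite addr_ge0 // exprn_ge0 // ltW.
Qed.

End EulerProduct.

(** * The final estimate *)

Section Truncation.
Variables (R : realType) (s : nat).

Lemma lambda_gt0 : 0 < lambda R.
Proof. by rewrite divr_gt0 ?mulr_gt0 ?exprn_gt0 ?pi_gt0 ?ln_gt0 ?ltr1n. Qed.

Let q := Num.sqrt (lambda R / s%:R).

Lemma sqrt_lambda_gt0 : (0 < s)%N -> 0 < q.
Proof. by move=> s_gt0; rewrite sqrtr_gt0 divr_gt0 ?lambda_gt0 ?ltr0n. Qed.

(** Maximality gives [#|QN s N.+1| > c m 2^m >= 2^m], so the exponential upper bound forces
    [sqrt (N+1) > q m]. Passing from [N+1] to [N] costs at most 1. *)
Lemma is_Nm_sqrt_ge (c : R) m N : (0 < s)%N -> 1 <= c * m%:R -> is_Nm s c m N ->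
  q * m%:R - 1 <= Num.sqrt N%:R.
Proof.
move=> s_gt0 cm1 [_ Nmax]; have q0 := sqrt_lambda_gt0 s_gt0.
have l0 : 0 < ln 2 :> R by rewrite ln_gt0 // ltr1n.
have a0 : 0 < Num.sqrt N.+1%:R :> R by rewrite sqrtr_gt0.
have qE : s%:R * pi ^+ 2 * q ^+ 2 = 3 * ln 2 ^+ 2.
  rewrite sqr_sqrtr; last by rewrite divr_ge0 // ltW ?lambda_gt0.
  have sR : 0 < s%:R :> R by rewrite ltr0n.
  rewrite /lambda; move: (ln 2) (@pi_gt0 R); move: pi s%:R sR => p n n0 l p0.
  by field; rewrite !gt_eqF.
have QN1 : 2 ^+ m < #|QN s N.+1|%:R :> R.
  apply: (@le_lt_trans _ _ (c * m%:R * 2 ^+ m)).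
    by rewrite ler_peMl // exprn_ge0.
  by rewrite ltNge; apply/negP => /Nmax; rewrite ltnn.
have := lt_le_trans QN1 (card_QN_le_expR a0 q0 (sqr_sqrtr (ler0n _ _)) qE).
rewrite -[X in X ^+ m](@lnK R 2) ?posrE // -expRM_natl ltr_expR mulrAC ltr_pM2r //.
rewrite ltr_pdivlMr // => qm.
have sub1 : Num.sqrt N.+1%:R <= Num.sqrt N%:R + 1 :> R.
  rewrite -ler_sqr ?nnegrE ?addr_ge0 ?sqrtr_ge0 // sqrrD !sqr_sqrtr //.
  by have := sqrtr_ge0 (N%:R : R); rewrite -natr1; lra.
by move: qm; rewrite [_ * q]mulrC; lra.
Qed.

(** A larger [N] would give Q_N at least [2^(4m) - 1] elements, more than [c m 2^m]. This keeps the
    factor [N^(r/4)] polynomial in [m] for each [r]. *)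
Lemma is_Nm_le (c : R) m N : (0 < s)%N -> 0 < c -> (0 < m)%N -> c + 1 <= m%:R ->
  is_Nm s c m N -> (N <= (4 * m) * (4 * m))%N.
Proof.
move=> s_gt0 c0 m0 cm [QNc _]; rewrite leqNgt; apply/negP => Nbig.
have := card_QN_ge s_gt0 (ltnW Nbig); rewrite -(ler_nat R) -natr1 natrX.
apply/negP; rewrite -ltNge.
have m2 : m%:R <= 2 ^+ m :> R by rewrite -natrX ler_nat ltnW // ltn_expl.
have m1 : 1 <= m%:R :> R by rewrite ler1n.
have p1 : 1 <= 2 ^+ m :> R by rewrite (le_trans m1).
have -> : 2 ^+ (4 * m) = (2 ^+ m) ^+ 4 :> R by rewrite -exprM mulnC.
move: QNc m2 p1; move: (2 ^+ m) (m%:R) m1 cm (_ %:R) => x y m1 cm z zc yx x1.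
have : c * y * x <= (x - 1) * x * x.
  by rewrite ler_pM2r ?ler_pM //; lra.
have x3 : 1 <= x * x * x by rewrite -[leLHS]mul1r ler_pM ?ler_pM //; nra.
rewrite !exprS expr0; nra.
Qed.

End Truncation.

Section FinalEstimate.
Variable R : realType.

Lemma ln_chord (b x : R) : 1 <= x -> x <= b -> (x - 1) * ln b <= b * ln x.
Proof.
move=> x1 xb; have x0 : 0 < x by lra.
have b0 : 0 < b by lra.
have lx0 : 0 <= ln x by exact: ln_ge0.
(* ln b <= ln x + (b / x - 1) and (x - 1) (b - x) / x <= (b - x) ln x *)
have lb : ln b <= ln x + (b / x - 1).
  have -> : ln b = ln x + ln (1 + (b / x - 1)).
    by rewrite [1 + _]addrC subrK ln_div ?posrE //; ring.
  rewrite lerD2l le_ln1Dx //.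
  by have := divr_gt0 b0 x0; lra.
have lx : 1 - x^-1 <= ln x.
  have : ln (1 + (x^-1 - 1)) <= x^-1 - 1.
    by rewrite le_ln1Dx //; move: x0; rewrite -invr_gt0; lra.
  by rewrite [1 + _]addrC subrK lnV ?posrE //; lra.
have E : (x - 1) * (b / x - 1) = (b - x) * (1 - x^-1) by field; rewrite gt_eqF.
have h1 : (x - 1) * ln b <= (x - 1) * (ln x + (b / x - 1)) by rewrite ler_wpM2l //; lra.
have h2 : (b - x) * (1 - x^-1) <= (b - x) * ln x by rewrite ler_wpM2l //; lra.
move: h1; rewrite mulrDr E; lra.
Qed.

(** In logarithms this is four times [ln_chord] at [x = r / 2]. *)
Lemma powR_chord (b : R) (r : nat) : 1 <= b -> (2 <= r)%N -> r%:R <= 2 * b ->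
  b ^+ (2 * r) * r%:R `^ (- (4 * b)) <= b ^+ 4 * 2 `^ (- (4 * b)).
Proof.
move=> b1 r2 rb; have b0 : 0 < b by lra.
have r2' : 2 <= r%:R :> R by rewrite ler_nat.
have r0 : 0 < r%:R :> R by lra.
rewrite -ler_ln ?posrE ?mulr_gt0 ?exprn_gt0 ?powR_gt0 //.
rewrite [leLHS]lnM ?[leRHS]lnM ?posrE ?exprn_gt0 ?powR_gt0 //.
rewrite !ln_powR !lnXn // -[ln b *+ (2 * r)]mulr_natl -[ln b *+ 4]mulr_natl.
have := @ln_chord b (r%:R / 2) ltac:(lra) ltac:(lra).
rewrite ln_div ?posrE // natrM; lra.
Qed.

(** Used with [b = c m], [x = N], [y = B sqrt N] and [u = #|QN s N| / 2^m]. The base is at most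
    [b^2], the deficit [B] in the exponent costs [r^B <= (2b)^B], and [powR_chord] replaces [r] by
    2. *)
Lemma dependent_term_le (A B b x y p u : R) (r : nat) :
  0 <= A -> 0 < B -> 1 <= b -> (2 <= r)%N -> r%:R <= 2 * b -> 0 <= x -> 0 <= u -> u <= b ->
  0 <= p -> p <= A ^+ r * (x `^ (r%:R / 4)) * (r%:R `^ (- y)) ->
  A * (x `^ (1 / 4)) * b <= b ^+ 2 -> 4 * b - B <= y ->
  p * u ^+ r <= b ^+ 4 * (2 * b) `^ B * 2 `^ (- (4 * b)).
Proof.
move=> A0 B0 b1 r2 rb x0 u0 ub p0 ple Axb yb.
have r2' : 2 <= r%:R :> R by rewrite ler_nat.
have xE : x `^ (r%:R / 4) = (x `^ (1 / 4)) ^+ r.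
  by rewrite -powR_mulrn ?powR_ge0 // -powRrM; congr (_ `^ _); field.
have yle : r%:R `^ (- y) <= (2 * b) `^ B * r%:R `^ (- (4 * b)).
  apply: (@le_trans _ _ (r%:R `^ (B + - (4 * b)))); first by rewrite ler_powR; lra.
  rewrite powRD; last by apply/implyP => _; apply/eqP; lra.
  by rewrite ler_wpM2r ?powR_ge0 // ge0_ler_powR ?nnegrE //; lra.
have := powR_chord b1 r2 rb.
have step : p * u ^+ r <= (A * x `^ (1 / 4) * b) ^+ r * r%:R `^ (- y).
  rewrite !exprMn -xE [leRHS]mulrAC ler_pM ?exprn_ge0 ?lerXn2r ?nnegrE //; lra.
have step2 : (A * x `^ (1 / 4) * b) ^+ r * r%:R `^ (- y) <=
    b ^+ (2 * r) * ((2 * b) `^ B * r%:R `^ (- (4 * b))).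
  rewrite ler_pM ?exprn_ge0 ?powR_ge0 ?mulr_ge0 ?powR_ge0 //; first by lra.
  rewrite exprM lerXn2r ?nnegrE ?mulr_ge0 ?powR_ge0 ?exprn_ge0 //; lra.
move=> chord; apply: (le_trans step); apply: (le_trans step2).
rewrite mulrCA [_ ^+ 4 * _]mulrC -mulrA.
by rewrite ler_wpM2l ?powR_ge0.
Qed.

End FinalEstimate.

Theorem theorem2 (R : realType) (s : nat) (A B : R) :
  (0 < s)%N -> 0 < A -> 0 < B ->
  (forall N r : nat, (1 <= N)%N -> (2 <= r)%N ->
     xor_prob R s N r <=
       A ^+ r * (N%:R `^ (r%:R / 4)) * (r%:R `^ (- (B * Num.sqrt N%:R)))) ->
  exists (d : R) (m0 : nat),
    forall f : 'rV[R]_s -> R, smooth_cube f ->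
    forall m N : nat, (m0 <= m)%N -> (0 < m)%N ->
      is_Nm s (c_const s B) m N ->
      dTV (@SUM1 R s N m f) (@SUM1' R s N m f) <=
        (c_const s B * m%:R)^-1 + m%:R `^ d * 2 `^ (- (4 * c_const s B * m%:R)).
Proof.
move=> s0 A0 B0 xorP.
have q0 := @sqrt_lambda_gt0 R s s0.
set q := Num.sqrt (lambda R / s%:R) in q0.
set c := c_const s B.
have cE : c = B / 4 * q by [].
clearbody c.
have c0 : 0 < c by rewrite cE !mulr_gt0.
have k1 : 0 < c^-1 by rewrite invr_gt0.
have k2 : 0 < q^-1 by rewrite invr_gt0.
have k3 : 0 < 4 * A ^+ 2 / c ^+ 2 by rewrite divr_gt0 ?mulr_gt0 ?exprn_gt0.
(* Each summand secures one inequality: [c m >= 1], [q m >= 2], [4 A^2 <= c^2 m]; the last two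
   together give [c + 1 <= m] and [2 c <= m]. *)
pose X := c^-1 + 2 * q^-1 + 4 * A ^+ 2 / c ^+ 2 + 2 * c + 1.
(* At most [2b] terms, each with the factor [b^4 (2b)^B], give [(2b)^(B+5)], and [2b <= m^2] doubles
   the exponent. *)
exists (2 * (B + 5)), (Num.bound X) => f _ m N m0m m0 NmP.
have mX : X < m%:R.
  by rewrite (lt_le_trans (archi_boundP _)) ?ler_nat // /X; lra.
rewrite /X in mX.
have m1 : 1 <= m%:R :> R by rewrite ler1n.
pose b := c * m%:R.
have b1 : 1 <= b by rewrite /b mulrC -ler_pdivrMr // div1r; lra.
have b0 : 0 < b by lra.
have qm : 2 <= q * m%:R by rewrite mulrC -ler_pdivrMr //; lra.
have AAc : 4 * A ^+ 2 <= c ^+ 2 * m%:R.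
  by rewrite [leRHS]mulrC -ler_pdivrMr ?exprn_gt0 //; lra.
have sqrtN := is_Nm_sqrt_ge s0 b1 NmP; rewrite -/q in sqrtN.
have N1 : (1 <= N)%N.
  rewrite lt0n; apply/eqP => N0; move: sqrtN; rewrite N0 sqrtr0; lra.
have N16 : N%:R <= (4 * m%:R) ^+ 2 :> R.
  rewrite expr2 -!natrM ler_nat.
  by apply: (is_Nm_le s0 c0 m0 _ NmP); lra.
have N4 : A * N%:R `^ (1 / 4) * b <= b ^+ 2.
  rewrite expr2 ler_pM2r //.
  have N4m : N%:R `^ (1 / 4) <= Num.sqrt (4 * m%:R) :> R.
    rewrite -powR12_sqrt ?mulr_ge0 // (_ : 1 / 4 = 2^-1 * 2^-1); last by field.
    rewrite powRrM ge0_ler_powR ?nnegrE ?powR_ge0 ?invr_ge0 ?mulr_ge0 //.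
    by rewrite powR12_sqrt // -[leRHS]ger0_norm ?mulr_ge0 // -sqrtr_sqr ler_wsqrtr.
  apply: (le_trans (ler_wpM2l (ltW A0) N4m)).
  rewrite -ler_sqr ?nnegrE ?mulr_ge0 ?sqrtr_ge0 //; [|exact: ltW|exact: ltW].
  rewrite /b !exprMn sqr_sqrtr ?mulr_ge0 //.
  by move: (ler_wpM2r (ler0n R m) AAc); rewrite !expr2; lra.
have muc : #|QN s N|%:R / 2 ^+ m <= b.
  by rewrite ler_pdivrMr ?exprn_gt0 //; case: NmP.
(* Cardinalities are integers, so not exceeding [2 * b] means being at most [K]. *)
pose K := Num.truncn (2 * b).
have Kb : K%:R <= 2 * b by rewrite truncn_le; lra.
have n0 : 0 < #|{: Omega s N m}|%:R :> R by rewrite ltr0n card_Omega_gt0.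
apply: (le_trans (@dTV_le_dependent R s N m f)).
pose bad1 := [set w : Omega s N m | 2 * b < #|Zset w|%:R]%SET.
pose bad2 := [set w : Omega s N m |
  ~~ `[< indep (Zset w) >] && (#|Zset w| <= K)%N]%SET.
have badU : #|[set w : Omega s N m | ~~ `[< indep (Zset w) >]]%SET|%:R <=
    #|bad1|%:R + #|bad2|%:R :> R.
  rewrite -natrD ler_nat (leq_trans _ (leq_card_setU _ _)) // subset_leq_card //.
  apply/fintype.subsetP => w; rewrite !inE => ->; rewrite /= ltNge.
  by case: leP => //= Zb; rewrite truncn_ge_nat //; lra.
have B1 := card_Zset_large b0 muc.
have B2 := card_dependent_small R s N m K.
apply: (@le_trans _ _ ((#|bad1|%:R + #|bad2|%:R) / #|{: Omega s N m}|%:R)).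
  by rewrite ler_pM2r ?invr_gt0.
rewrite mulrDl lerD //.
  by rewrite ler_pdivrMr // mulrC.
rewrite ler_pdivrMr // mulrC (le_trans B2) // ler_wpM2l ?ler0n //.
have term r : (2 <= r < K)%N -> xor_prob R s N r * (#|QN s N|%:R / 2 ^+ m) ^+ r <=
    b ^+ 4 * (2 * b) `^ B * 2 `^ (- (4 * b)).
  move=> /andP[r2 rK]; apply: dependent_term_le (xorP N r N1 r2) N4 _ => //.
  - exact: ltW.
  - by rewrite (le_trans _ Kb) // ler_nat ltnW.
  - by rewrite divr_ge0 ?exprn_ge0.
  (* Since [c = B q / 4], the product [B (q m - 1)] is [4 b - B]. *)
  - have := ler_wpM2l (ltW B0) sqrtN; rewrite /b cE; lra.
rewrite (le_trans (ler_sum_nat term)) // sumr_const_nat -[leLHS]mulr_natl [leLHS]mulrA.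
rewrite -[4 * c * _]mulrA -/b ler_wpM2r ?powR_ge0 //.
apply: (@le_trans _ _ ((2 * b) `^ (B + 5))).
  rewrite powRD; last by apply/implyP => _; apply/eqP; lra.
  rewrite [leRHS]mulrC mulrA ler_wpM2r ?powR_ge0 //.
  rewrite powR_mulrn; last by lra.
  rewrite [leRHS]exprS ler_pM ?exprn_ge0 //; [lra| |].
    by rewrite (le_trans _ Kb) // ler_nat leq_subr.
  by rewrite lerXn2r ?nnegrE //; lra.
rewrite powRrM powR_mulrn // ge0_ler_powR ?nnegrE ?exprn_ge0 //; [lra|lra|].
by rewrite expr2 /b mulrA ler_wpM2r //; lra.
Qed.
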